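(* Let $p \ge 1$ and $1 \le s \le p$ be integers, let $Z \in \mathbb{R}^{2^p \times p}$ be the subset incidence matrix and $W \in \mathbb{R}^{2^p\times 2^p}$ the diagonal matrix of Shapley weights (both defined in the context), and let $t \in \mathbb{R}^{2^p}$ be fixed. Define $$l(\gamma) = \frac{1}{2}(Z\gamma - t)^\top W (Z\gamma - t), \qquad \gamma \in \mathbb{R}^p .$$ Let $\rho > 0$ satisfy $\rho \ge \|Z^\top W Z\|_2$, where $\|\cdot\|_2$ denotes the matrix spectral norm. Let $\gamma^{(0)} \in \mathbb{R}^p$ be any initial point with $\|\gamma^{(0)}\|_0 \le s$ and $\|\gamma^{(0)}\|_2 = 1$, and let $\{\gamma^{(k)}\}_{k \ge 0}$ be generated by $$\gamma^{(k+1)} = \mathcal{H}^\circ(y^{(k)}; s) = \frac{\mathcal{H}(y^{(k)}; s)}{\|\mathcal{H}(y^{(k)}; s)\|_2}, \qquad y^{(k)} = \gamma^{(k)} - \frac{1}{\rho} Z^\top W (Z\gamma^{(k)} - t), \qquad k \ge 0,$$ where it is understood that the iteration is well defined, i.e. $\mathcal{H}(y^{(k)}; s) \neq 0$ for all $k \ge 0$. Then the function values are non-increasing (and thus convergent): $$l(\gamma^{(k+1)}) \le l(\gamma^{(k)}) \quad \text{for all } k \ge 0 .$$ Furthermore, if $\rho > \|Z^\top W Z\|_2$, then $\|\gamma^{(k+1)} - \gamma^{(k)}\|_2 \to 0$ as $k \to \infty$.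
   Context: Let $F = \{1, \ldots, p\}$ and fix an ordering of the $2^p$ subsets $A \subseteq F$, used to index the rows of $Z$, the diagonal of $W$ and the entries of $t$. The incidence matrix $Z \in \mathbb{R}^{2^p \times p}$ has entries $Z_{A,j} = 1$ if $j \in A$ and $Z_{A,j} = 0$ otherwise, so that $(Z\gamma)_A = \sum_{j \in A} \gamma_j$. The weight matrix is $W = \mathrm{diag}\{w(A)\}_{A \subseteq F}$, where for $A \neq \emptyset, F$ $$w(A) = \frac{p-1}{\binom{p}{|A|}\,|A|\,(p - |A|)},$$ and $w(\emptyset)$, $w(F)$ are (large) finite positive numbers. For $\gamma \in \mathbb{R}^p$, $\|\gamma\|_0$ denotes the number of nonzero entries of $\gamma$ and $\|\gamma\|_2$ the Euclidean norm. The hard-thresholding operator $\mathcal{H}(\cdot; s)$ is defined by $\mathcal{H}(y; s) = z$, where $z_i = y_i$ if $|y_i|$ is among the $s$ largest of $|y_1|, \ldots, |y_p|$, and $z_i = 0$ otherwise; in case of ties, an arbitrary set of exactly $s$ indices carrying the $s$ largest absolute values is selected. The normalized hard-thresholding operator is $\mathcal{H}^\circ(y; s) = \mathcal{H}(y; s)/\|\mathcal{H}(y; s)\|_2$ whenever $\|\mathcal{H}(y; s)\|_2 \neq 0$. *)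

(* Defs.v *)
From mathcomp Require Import all_boot all_order all_algebra.
From mathcomp Require Import all_classical all_reals all_analysis.

Set Implicit Arguments.
Unset Strict Implicit.
Unset Printing Implicit Defensive.

Import Order.TTheory GRing.Theory Num.Theory.
Import numFieldNormedType.Exports.

Local Open Scope classical_set_scope.
Local Open Scope ring_scope.

(* The norm that MathComp-Analysis puts on matrices is the max norm, hence the
   separate Euclidean and spectral norms. *)
Definition l2norm (R : realType) (n : nat) (x : 'cV[R]_n) : R :=
  Num.sqrt (\sum_i x i 0 ^+ 2).

Definition l0norm (R : realType) (n : nat) (x : 'cV[R]_n) : nat :=
  #|[pred i | x i 0 != 0]|.

Definition spectral_norm (R : realType) (m n : nat) (M : 'M[R]_(m, n)) : R :=
  sup [set l2norm (M *m x) | x in [set x : 'cV[R]_n | l2norm x <= 1]].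

(* The supremum is always that of a nonempty bounded set, so it never takes
   the default value of [sup]. *)
Lemma has_sup_spectral_norm (R : realType) (m n : nat) (M : 'M[R]_(m, n)) :
  has_sup [set l2norm (M *m x) | x in [set x : 'cV[R]_n | l2norm x <= 1]].
Proof.
split.
  exists (l2norm (M *m 0)), 0 => //=.
  by rewrite /l2norm big1 ?sqrtr0 // => i _; rewrite mxE expr0n.
exists (Num.sqrt (\sum_i (\sum_j `|M i j|) ^+ 2)) => _ [x /= x1 <-].
have x1j j : `|x j 0| <= 1.
  apply: le_trans x1; rewrite -sqrtr_sqr ler_wsqrtr // (bigD1 j) //= lerDl.
  by apply: sumr_ge0 => i _; exact: sqr_ge0.
rewrite ler_wsqrtr //; apply: ler_sum => i _.
rewrite -real_normK ?num_real // ler_sqr ?nnegrE ?sumr_ge0 // mxE.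
apply: le_trans (ler_norm_sum _ _ _) _; apply: ler_sum => j _.
by rewrite normrM ler_piMr.
Qed.

(* [ord] is the chosen ordering of the 2 ^ p subsets of F = 'I_p. *)
Definition incidence_mx (R : realType) (p : nat)
    (ord : 'I_(2 ^ p) -> {set 'I_p}) : 'M[R]_(2 ^ p, p) :=
  \matrix_(a, j) (j \in ord a)%:R.

(* [w0] and [wF] are the weights of the empty set and of F. *)
Definition shapley_weight (R : realType) (p : nat) (w0 wF : R)
    (A : {set 'I_p}) : R :=
  if A == finset.set0 then w0
  else if A == [set: 'I_p]%SET then wF
  else (p%:R - 1) / ('C(p, #|A|)%:R * #|A|%:R * (p%:R - #|A|%:R)).

Definition shapley_weight_mx (R : realType) (p : nat)
    (ord : 'I_(2 ^ p) -> {set 'I_p}) (w0 wF : R) : 'M[R]_(2 ^ p) :=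
  diag_mx (\row_a shapley_weight w0 wF (ord a)).

Definition wls_loss (R : realType) (m p : nat) (Z : 'M[R]_(m, p))
    (W : 'M[R]_m) (t : 'cV[R]_m) (g : 'cV[R]_p) : R :=
  2^-1 * ((Z *m g - t)^T *m W *m (Z *m g - t)) 0 0.

Definition gradient_step (R : realType) (m p : nat) (Z : 'M[R]_(m, p))
    (W : 'M[R]_m) (t : 'cV[R]_m) (rho : R) (g : 'cV[R]_p) : 'cV[R]_p :=
  g - rho^-1 *: (Z^T *m W *m (Z *m g - t)).

(* Hard thresholding is a relation because ties are broken arbitrarily: z is
   one of the possible values of H(y; s). *)
Definition hard_threshold (R : realType) (p s : nat) (y z : 'cV[R]_p) : Prop :=
  exists S : {set 'I_p},
    [/\ #|S| = s,
        forall i j, i \in S -> j \notin S -> `|y j 0| <= `|y i 0|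
      & z = \col_i (if i \in S then y i 0 else 0)].

Definition normalized_hard_threshold (R : realType) (p s : nat)
    (y g : 'cV[R]_p) : Prop :=
  exists z : 'cV[R]_p,
    [/\ hard_threshold s y z, l2norm z != 0 & g = (l2norm z)^-1 *: z].

(* Main.v *)
(** Write [M = Z^T W Z], [L] for its spectral norm, [a = gamma k],
    [b = gamma k.+1] and [y] for the gradient step from [a], so that the
    gradient of the loss at [a] is [rho (a - y)].  Since [a] and [b] are unit
    vectors, [<a - y, b - a> = <y, a> - <y, b> - |b - a|^2 / 2], and the exact
    second-order expansion of the loss gives
      [l b - l a <= rho (<y, a> - <y, b>) - (rho - L) / 2 * |b - a|^2].
    Moreover [b] maximizes [<y, .>] over [s]-sparse unit vectors: by
    Cauchy-Schwarz the maximum over vectors supported in [T] is the norm of [y]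
    restricted to [T], and hard thresholding selects the [T] for which this norm
    is largest.  Hence the loss decreases by at least
    [(rho - L) / 2 * |b - a|^2]; being nonnegative it converges, and its
    increments tend to [0]. *)
Require Import Defs.
From mathcomp Require Import all_boot all_order all_algebra.
From mathcomp Require Import all_classical all_reals all_analysis.
From mathcomp Require Import ring lra.

Set Implicit Arguments.
Unset Strict Implicit.
Unset Printing Implicit Defensive.

Import Order.TTheory GRing.Theory Num.Theory.
Import numFieldNormedType.Exports.
Local Open Scope classical_set_scope.
Local Open Scope ring_scope.

Definition dotcv {R : realType} {n : nat} (u v : 'cV[R]_n) : R :=
  (u^T *m v) 0 0.

Lemma dotcvE (R : realType) n (u v : 'cV[R]_n) :
  dotcv u v = \sum_i u i 0 * v i 0.
Proof. by rewrite /dotcv mxE; apply: eq_bigr => i _; rewrite mxE. Qed.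

Lemma dotcvC (R : realType) n (u v : 'cV[R]_n) : dotcv u v = dotcv v u.
Proof. by rewrite !dotcvE; apply: eq_bigr => i _; rewrite mulrC. Qed.

Lemma dotcvDr (R : realType) n (u v w : 'cV[R]_n) :
  dotcv u (v + w) = dotcv u v + dotcv u w.
Proof. by rewrite /dotcv mulmxDr mxE. Qed.

Lemma dotcvZr (R : realType) n c (u v : 'cV[R]_n) :
  dotcv u (c *: v) = c * dotcv u v.
Proof. by rewrite /dotcv -scalemxAr mxE. Qed.

Lemma dotcvBr (R : realType) n (u v w : 'cV[R]_n) :
  dotcv u (v - w) = dotcv u v - dotcv u w.
Proof. by rewrite dotcvDr -scaleN1r dotcvZr mulN1r. Qed.

Lemma dotcvDl (R : realType) n (u v w : 'cV[R]_n) :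
  dotcv (u + v) w = dotcv u w + dotcv v w.
Proof. by rewrite dotcvC dotcvDr !(dotcvC w). Qed.

Lemma dotcvBl (R : realType) n (u v w : 'cV[R]_n) :
  dotcv (u - v) w = dotcv u w - dotcv v w.
Proof. by rewrite dotcvC dotcvBr !(dotcvC w). Qed.

Lemma dotcvZl (R : realType) n c (u v : 'cV[R]_n) :
  dotcv (c *: u) v = c * dotcv u v.
Proof. by rewrite dotcvC dotcvZr dotcvC. Qed.

Lemma dotcv_mulmx (R : realType) m n (A : 'M[R]_(m, n)) u v :
  dotcv (A *m u) v = dotcv u (A^T *m v).
Proof. by rewrite /dotcv trmx_mul mulmxA. Qed.

Lemma l2norm_ge0 (R : realType) n (u : 'cV[R]_n) : 0 <= l2norm u.
Proof. exact: sqrtr_ge0. Qed.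

Lemma dotcvv (R : realType) n (u : 'cV[R]_n) : dotcv u u = l2norm u ^+ 2.
Proof.
rewrite /l2norm sqr_sqrtr; last by apply: sumr_ge0 => i _; exact: sqr_ge0.
by rewrite dotcvE.
Qed.

Lemma l2norm0_eq0 (R : realType) n (u : 'cV[R]_n) : l2norm u = 0 -> u = 0.
Proof.
move=> /eqP; rewrite -sqrf_eq0 -dotcvv dotcvE psumr_eq0; last first.
  by move=> i _; exact: sqr_ge0.
move=> /allP u0; apply/colP => i; apply/eqP; rewrite mxE -sqrf_eq0.
exact: u0 (mem_index_enum i).
Qed.

Lemma l2normZ (R : realType) n c (u : 'cV[R]_n) :
  l2norm (c *: u) = `|c| * l2norm u.
Proof.
apply/eqP; rewrite -(eqrXn2 (n := 2)) ?mulr_ge0 ?l2norm_ge0 //.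
by rewrite -dotcvv dotcvZl dotcvZr dotcvv exprMn real_normK ?num_real// mulrA.
Qed.

Lemma l2norm_normalize (R : realType) n (u : 'cV[R]_n) :
  l2norm u != 0 -> l2norm ((l2norm u)^-1 *: u) = 1.
Proof.
by move=> u0; rewrite l2normZ ger0_norm ?invr_ge0 ?l2norm_ge0 // mulVf.
Qed.

(** Cauchy-Schwarz: expand the squared norm of [l2norm v *: u - l2norm u *: v] and cancel the factor
    [l2norm u * l2norm v], which is positive once zero vectors are set aside. *)
Lemma dotcv_le_l2norm (R : realType) n (u v : 'cV[R]_n) :
  dotcv u v <= l2norm u * l2norm v.
Proof.
have [/l2norm0_eq0 ->|u0] := eqVneq (l2norm u) 0.
  by rewrite /dotcv trmx0 mul0mx mxE mulr_ge0 ?l2norm_ge0.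
have [/l2norm0_eq0 ->|v0] := eqVneq (l2norm v) 0.
  by rewrite /dotcv mulmx0 mxE mulr_ge0 ?l2norm_ge0.
have a0 : 0 < l2norm u by rewrite lt_neqAle eq_sym u0 l2norm_ge0.
have b0 : 0 < l2norm v by rewrite lt_neqAle eq_sym v0 l2norm_ge0.
rewrite -(ler_pM2l (mulr_gt0 a0 b0)).
have := sqr_ge0 (l2norm (l2norm v *: u - l2norm u *: v)).
rewrite -dotcvv dotcvBl !dotcvBr !(dotcvZl, dotcvZr) (dotcvC v u) !dotcvv; nra.
Qed.

Lemma l2norm_mulmx_le (R : realType) m n (A : 'M[R]_(m, n)) (u : 'cV[R]_n) :
  l2norm (A *m u) <= spectral_norm A * l2norm u.
Proof.
have [u0|u0] := eqVneq (l2norm u) 0.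
  by rewrite u0 (l2norm0_eq0 u0) mulmx0 -(scale0r 0) l2normZ normr0 mul0r mulr0.
have a0 : 0 < l2norm u by rewrite lt_neqAle eq_sym u0 l2norm_ge0.
rewrite -ler_pdivrMr // mulrC.
have -> : (l2norm u)^-1 * l2norm (A *m u) = l2norm (A *m ((l2norm u)^-1 *: u)).
  by rewrite -scalemxAr l2normZ ger0_norm // invr_ge0 l2norm_ge0.
apply: ub_le_sup; first by case: (has_sup_spectral_norm A).
by exists ((l2norm u)^-1 *: u) => //=; rewrite l2norm_normalize.
Qed.

Lemma quadratic_form_le (R : realType) n (A : 'M[R]_n) (u : 'cV[R]_n) :
  dotcv u (A *m u) <= spectral_norm A * l2norm u ^+ 2.
Proof.
apply: le_trans (dotcv_le_l2norm _ _) _.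
by rewrite expr2 mulrCA ler_wpM2l ?l2norm_ge0 // l2norm_mulmx_le.
Qed.

(** Exact because the loss is quadratic; symmetry of [W] makes the two cross terms equal, so that
    with the factor 1/2 they add up to the gradient term. *)
Lemma wls_lossD (R : realType) m p (Z : 'M[R]_(m, p)) (W : 'M[R]_m) t a d :
  W^T = W ->
  wls_loss Z W t (a + d) = wls_loss Z W t a
    + dotcv d (Z^T *m W *m (Z *m a - t)) + 2^-1 * dotcv d (Z^T *m W *m Z *m d).
Proof.
move=> Wsym; have lossE g :
    wls_loss Z W t g = 2^-1 * dotcv (Z *m g - t) (W *m (Z *m g - t)).
  by rewrite /wls_loss /dotcv mulmxA.
rewrite !lossE (mulmxDr Z) (addrAC (Z *m a)); set r := Z *m a - t.
rewrite mulmxDr dotcvDl !dotcvDr (dotcvC r (W *m (Z *m d))) dotcv_mulmx Wsym.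
by rewrite !(dotcv_mulmx Z) !mulmxA; field.
Qed.

(** The smallest square [c] on the nonempty set [S] is a level separating [S] from its complement.
    Sums shifted by this level compare termwise, and since [c] is nonnegative, [#|T| <= #|S|] allows
    the shift to be undone. *)
Lemma hard_threshold_sum_max (R : realType) p (S T : {set 'I_p})
    (y : 'cV[R]_p) :
  (0 < #|S|)%N -> (#|T| <= #|S|)%N ->
  (forall i j, i \in S -> j \notin S -> `|y j 0| <= `|y i 0|) ->
  \sum_(i in T) y i 0 ^+ 2 <= \sum_(i in S) y i 0 ^+ 2.
Proof.
move=> /card_gt0P[i0 i0S] leTS Smax.
have sqr_le i j : `|y i 0| <= `|y j 0| -> y i 0 ^+ 2 <= y j 0 ^+ 2.
  by rewrite -ler_sqr ?nnegrE // !real_normK ?num_real.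
case: (arg_minP (fun i => `|y i 0|) i0S) => i1 i1S i1min.
pose c := y i1 0 ^+ 2.
have shift (A : {set 'I_p}) :
    \sum_(i in A) (y i 0 ^+ 2 - c) = \sum_(i in A) y i 0 ^+ 2 - c *+ #|A|.
  by rewrite big_split /= sumrN sumr_const.
(* After subtracting [c], the summands are nonnegative on [S] and nonpositive
   off [S]. *)
suff : \sum_(i in T) (y i 0 ^+ 2 - c) <= \sum_(i in S) (y i 0 ^+ 2 - c).
  have : c *+ #|T| <= c *+ #|S| by rewrite ler_wpMn2l ?sqr_ge0.
  by rewrite !shift; lra.
rewrite !(big_mkcond (fun i => i \in _)) /=; apply: ler_sum => i _.
have [iS|iS] := boolP (i \in S).
  have : 0 <= y i 0 ^+ 2 - c by rewrite subr_ge0 sqr_le ?i1min.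
  by case: ifP.
have : y i 0 ^+ 2 - c <= 0 by rewrite subr_le0 sqr_le ?Smax.
by case: ifP.
Qed.

Lemma normalized_hard_threshold_dot_max (R : realType) p s (y a b : 'cV[R]_p) :
  (0 < s)%N -> normalized_hard_threshold s y b ->
  (l0norm a <= s)%N -> l2norm a = 1 -> dotcv y a <= dotcv y b.
Proof.
move=> s0 [z [[S [cS Smax zE]] z0 ->]] a_sparse a1.
have sqE (A : {set 'I_p}) : \sum_(i in A) y i 0 ^+ 2
    = l2norm (\col_i (if i \in A then y i 0 else 0)) ^+ 2.
  rewrite -dotcvv dotcvE big_mkcond; apply: eq_bigr => i _; rewrite mxE.
  by case: ifP; rewrite ?mulr0.
(* [z] agrees with [y] on [S] and vanishes elsewhere; hence the value attained at [b] is exactly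
   [l2norm z]. *)
have yz : dotcv y z = l2norm z ^+ 2.
  rewrite zE -sqE dotcvE [RHS]big_mkcond; apply: eq_bigr => i _; rewrite mxE.
  by case: ifP; rewrite ?mulr0.
rewrite dotcvZr yz expr2 mulKf //.
pose T := [set i | a i 0 != 0]%SET.
pose yT : 'cV_p := \col_i (if i \in T then y i 0 else 0).
(* Cutting [y] down to the support of [a] first makes Cauchy-Schwarz yield the norm of [yT] instead
   of that of [y]. *)
have -> : dotcv y a = dotcv yT a.
  rewrite !dotcvE; apply: eq_bigr => i _; rewrite !mxE inE.
  by case: eqP => // ->; rewrite !mulr0.
apply: le_trans (dotcv_le_l2norm _ _) _.
rewrite a1 mulr1 -ler_sqr ?nnegrE ?l2norm_ge0 // -sqE zE -sqE.
apply: hard_threshold_sum_max; rewrite ?cS //.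
by rewrite /T cardsE.
Qed.

Lemma normalized_hard_threshold_unit (R : realType) p s (y b : 'cV[R]_p) :
  normalized_hard_threshold s y b -> l2norm b = 1.
Proof. by move=> [z [_ z0 ->]]; exact: l2norm_normalize. Qed.

Lemma normalized_hard_threshold_sparse (R : realType) p s (y b : 'cV[R]_p) :
  normalized_hard_threshold s y b -> (l0norm b <= s)%N.
Proof.
move=> [z [[S [<- _ ->]] _ ->]]; apply: subset_leq_card.
apply/fintype.subsetP => i; rewrite inE !mxE.
by case: ifP; rewrite ?mulr0 ?eqxx.
Qed.

Lemma wls_loss_descent (R : realType) m p s (Z : 'M[R]_(m, p)) (W : 'M[R]_m)
    t rho a b :
  (0 < s)%N -> W^T = W -> 0 < rho ->
  (l0norm a <= s)%N -> l2norm a = 1 ->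
  normalized_hard_threshold s (gradient_step Z W t rho a) b ->
  (rho - spectral_norm (Z^T *m W *m Z)) / 2 * l2norm (b - a) ^+ 2
    <= wls_loss Z W t a - wls_loss Z W t b.
Proof.
move=> s0 Wsym rho0 a_sparse a1 Hb.
have b1 := normalized_hard_threshold_unit Hb.
have step : 0 <= rho * dotcv (gradient_step Z W t rho a) (b - a).
  rewrite mulr_ge0 ?(ltW rho0) // dotcvBr subr_ge0.
  exact: normalized_hard_threshold_dot_max s0 Hb a_sparse a1.
have -> : wls_loss Z W t b = wls_loss Z W t (a + (b - a)).
  by rewrite addrC subrK.
have := quadratic_form_le (Z^T *m W *m Z) (b - a).
move: step; rewrite wls_lossD // /gradient_step.
rewrite dotcvC dotcvBr dotcvZr mulrBr mulVKf ?gt_eqF // -dotcvv.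
(* Both sides equal [2 - 2 <a, b>] for unit vectors. This turns the linear term [rho <b - a, a>]
   into [- rho / 2 * |b - a|^2]. *)
have -> : dotcv (b - a) (b - a) = - 2 * dotcv (b - a) a.
  by rewrite !dotcvBl !dotcvBr (dotcvC a b) !dotcvv a1 b1; ring.
lra.
Qed.

Lemma shapley_weight_ge0 (R : realType) p (w0 wF : R) (A : {set 'I_p}) :
  0 <= w0 -> 0 <= wF -> 0 <= shapley_weight w0 wF A.
Proof.
move=> w0_ge0 wF_ge0; rewrite /shapley_weight; case: eqP => [//|/eqP A0].
case: eqP => // _; have cA := max_card (mem A); rewrite card_ord in cA.
(* A nonempty [A] forces [p >= 1], so the numerator [p - 1] is nonnegative. *)
have : (0 < #|A|)%N by rewrite card_gt0.
move=> /leq_trans/(_ cA) p0.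
rewrite divr_ge0 ?mulr_ge0 ?ler0n ?subr_ge0 ?ler_nat //.
by rewrite ler1n.
Qed.

(** Half a weighted sum of squared residuals; this lower bound makes the decreasing loss values
    converge. *)
Lemma wls_loss_diag_ge0 (R : realType) m p (Z : 'M[R]_(m, p)) (w : 'rV[R]_m)
    t g :
  (forall i, 0 <= w 0 i) -> 0 <= wls_loss Z (diag_mx w) t g.
Proof.
move=> w_ge0; rewrite /wls_loss mulr_ge0 ?invr_ge0 // mxE sumr_ge0 // => i _.
by rewrite mul_mx_diag !mxE mulrAC mulr_ge0 // -expr2 sqr_ge0.
Qed.

Theorem theorem2 (R : realType) (p s : nat)
    (p_ge1 : (1 <= p)%N) (s_ge1 : (1 <= s)%N) (s_le_p : (s <= p)%N)
    (ord : 'I_(2 ^ p) -> {set 'I_p}) (ord_bij : bijective ord)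
    (w0 wF : R) (w0_gt0 : 0 < w0) (wF_gt0 : 0 < wF)
    (Z : 'M[R]_(2 ^ p, p)) (defZ : Z = incidence_mx R ord)
    (W : 'M[R]_(2 ^ p)) (defW : W = shapley_weight_mx ord w0 wF)
    (t : 'cV[R]_(2 ^ p))
    (rho : R) (rho_gt0 : 0 < rho)
    (rho_ge : spectral_norm (Z^T *m W *m Z) <= rho)
    (gamma : nat -> 'cV[R]_p)
    (gamma0_sparse : (l0norm (gamma 0%N) <= s)%N)
    (gamma0_unit : l2norm (gamma 0%N) = 1)
    (gammaS : forall k : nat,
      normalized_hard_threshold s (gradient_step Z W t rho (gamma k))
        (gamma k.+1)) :
  [/\ forall k : nat,
        wls_loss Z W t (gamma k.+1) <= wls_loss Z W t (gamma k),
      cvgn (fun k : nat => wls_loss Z W t (gamma k))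
    & spectral_norm (Z^T *m W *m Z) < rho ->
      (fun k : nat => l2norm (gamma k.+1 - gamma k)) @ \oo --> (0 : R)].
Proof.
have Wsym : W^T = W by rewrite defW tr_diag_mx.
have descent k : (rho - spectral_norm (Z^T *m W *m Z)) / 2
      * l2norm (gamma k.+1 - gamma k) ^+ 2
    <= wls_loss Z W t (gamma k) - wls_loss Z W t (gamma k.+1).
  (* The initial point is sparse and of unit norm by assumption, every later iterate as an output of
     thresholding. *)
  apply: (wls_loss_descent (s := s)) => //.
    by case: k => // k; exact: normalized_hard_threshold_sparse (gammaS k).
  by case: k => // k; exact: normalized_hard_threshold_unit (gammaS k).
set l := fun k => wls_loss Z W t (gamma k).
have l_decr k : l k.+1 <= l k.
  rewrite -subr_ge0; apply: le_trans (descent k).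
  by rewrite mulr_ge0 ?sqr_ge0 // divr_ge0 ?subr_ge0.
have l_cvg : cvgn l.
  apply: nonincreasing_is_cvgn; first exact/nonincreasing_seqP.
  exists 0 => _ [k _ <-]; rewrite /l defW; apply: wls_loss_diag_ge0 => i.
  by rewrite mxE shapley_weight_ge0 ?ltW.
split=> // rho_gt; set L := spectral_norm _ in descent rho_gt.
(* [u k] is the bound on the step length obtained by solving [descent k] for it, which requires
   [L < rho]. *)
pose u k := Num.sqrt (2 / (rho - L) * (l k - l k.+1)).
have u0 : u @ \oo --> 0.
  rewrite -[0]sqrtr0; apply: continuous_cvg; first exact: sqrt_continuous.
  rewrite -[0](mulr0 (2 / (rho - L))); apply: cvgMl_tmp.
  (* The decrements vanish because [l] and its shift have the same limit. *)
  rewrite -(subrr (limn l)); apply: cvgB => //.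
  by rewrite (cvg_shiftS l).
apply: (squeeze_cvgr _ (cvg_cst 0) u0); apply: nearW => k.
rewrite l2norm_ge0 /=.
rewrite -[leLHS]ger0_norm ?l2norm_ge0 // -sqrtr_sqr ler_wsqrtr //.
have rL : 0 < rho - L by rewrite subr_gt0.
rewrite -ler_pdivrMl ?divr_gt0 // invf_div; exact: descent.
Qed.
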